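(* There exists a bounded linear operator $U:\ell_1\to\ell_1$ with $\Vert U\Vert=1$ such that for every separable Banach space $X$, every bounded linear operator $T:X\to X$, and every real number $\rho\ge\Vert T\Vert$, the operator $T$ is a linear factor of $\rho\cdot U$.
   Context: $\ell_1=\ell_1(\mathbb{N})$ is the Banach space of absolutely summable scalar sequences with its usual norm; all Banach spaces are over one fixed scalar field ($\mathbb{R}$ or $\mathbb{C}$). If $T:X\to X$ and $S:E\to E$ are bounded linear operators on Banach spaces, $T$ is a linear factor of $S$ if there is a continuous linear map $\pi:E\to X$ which is onto and satisfies $T\pi=\pi S$. *)

(* Defs.v *)
From HB Require Import structures.
From mathcomp Require Import all_boot all_order all_algebra.
From mathcomp Require Import complex.
From mathcomp Require Import all_classical all_reals all_analysis.

Set Implicit Arguments.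
Unset Strict Implicit.
Unset Printing Implicit Defensive.

Import Order.TTheory GRing.Theory Num.Theory.
Import numFieldNormedType.Exports.

Local Open Scope classical_set_scope.
Local Open Scope ring_scope.

Inductive scalar_kind := RealScalars | ComplexScalars.

Definition scalar_field (R : realType) (k : scalar_kind) : numFieldType :=
  match k with
  | RealScalars => R
  | ComplexScalars => R[i]
  end.

Definition of_real (R : realType) (k : scalar_kind) : R -> scalar_field R k :=
  match k with
  | RealScalars => fun r => r
  | ComplexScalars => fun r => r%:C%C
  end.

(* The norm of a [numFieldType] takes its values in the field itself; [modulus]
   is its real-valued version, see [of_real_modulus]. *)
Definition modulus (R : realType) (k : scalar_kind) : scalar_field R k -> R :=
  match k with
  | RealScalars => fun z => `|z|
  | ComplexScalars => fun z => complex.Re `|z|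
  end.

Section scalars.
Variables (R : realType) (k : scalar_kind).
Local Notation K := (scalar_field R k).

Lemma of_real_modulus (z : K) : of_real k (modulus z) = `|z|.
Proof. by case: k z => //= z; rewrite normc_def. Qed.

Lemma of_real_le (x y : R) : (of_real k x <= of_real k y) = (x <= y).
Proof. by case: k => //=; rewrite lecR. Qed.

Lemma of_real_lt (x y : R) : (of_real k x < of_real k y) = (x < y).
Proof. by case: k => //=; rewrite ltcR. Qed.

Lemma of_realD (x y : R) : of_real k (x + y) = of_real k x + of_real k y.
Proof. by case: k => //=; rewrite rmorphD. Qed.

Lemma of_realM (x y : R) : of_real k (x * y) = of_real k x * of_real k y.
Proof. by case: k => //=; rewrite rmorphM. Qed.

Lemma of_real0 : of_real k 0 = 0 :> K.
Proof. by case: k. Qed.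

Lemma of_real_inj : injective (@of_real R k).
Proof. by move=> x y xy; apply/eqP; rewrite eq_le -!of_real_le xy lexx. Qed.

Lemma gt0_of_real (z : K) : 0 < z -> z = of_real k (modulus z).
Proof. by move=> z0; rewrite of_real_modulus gtr0_norm. Qed.

Lemma modulus_ge0 (z : K) : 0 <= modulus z.
Proof. by rewrite -of_real_le of_real_modulus of_real0. Qed.

Lemma modulusD (x y : K) : modulus (x + y) <= modulus x + modulus y.
Proof. by rewrite -of_real_le of_realD !of_real_modulus ler_normD. Qed.

Lemma modulusM (x y : K) : modulus (x * y) = modulus x * modulus y.
Proof. by apply: of_real_inj; rewrite of_realM !of_real_modulus normrM. Qed.

Lemma modulus0 : modulus (0 : K) = 0.
Proof. by apply: of_real_inj; rewrite of_real_modulus of_real0 normr0. Qed.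

Lemma modulus_eq0 (z : K) : modulus z = 0 -> z = 0.
Proof.
by move=> z0; apply/eqP; rewrite -normr_eq0 -of_real_modulus z0 of_real0.
Qed.

End scalars.

Lemma modulus_dist (R : realType) (k : scalar_kind) (x y : scalar_field R k) :
  `|modulus x - modulus y| <= modulus (x - y).
Proof.
have modulusB (u v : scalar_field R k) :
    modulus u <= modulus (u - v) + modulus v.
  by rewrite -{1}(subrK v u) modulusD.
have modulusC (u v : scalar_field R k) : modulus (u - v) = modulus (v - u).
  by apply: (@of_real_inj R k); rewrite !of_real_modulus distrC.
rewrite ler_distl; apply/andP; split; last by rewrite addrC modulusB.
by rewrite lerBlDr addrC modulusC modulusB.
Qed.

Lemma modulus_cvg (R : realType) (k : scalar_kind) (T : Type)
    (F : set_system T) (FF : Filter F)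
    (f : T -> scalar_field R k) (l : scalar_field R k) :
  f @ F --> l -> (fun t => modulus (f t)) @ F --> modulus l.
Proof.
move=> fl; apply/cvgrPdist_lt => e e0.
have e0' : 0 < of_real k e by rewrite -(of_real0 R k) of_real_lt.
move/cvgrPdist_lt: fl => /(_ _ e0'); apply: filterS => t /= fl.
apply: le_lt_trans (modulus_dist _ _) _.
by rewrite -(of_real_lt k) of_real_modulus.
Qed.

Lemma normc_le_ReIm (R : realType) (z : R[i]) :
  `|z| <= (`|complex.Re z| + `|complex.Im z|)%:C%C.
Proof.
have normC (r : R) : `|r%:C%C| = `|r|%:C%C :> R[i].
  by rewrite normc_def /= expr0n /= addr0 sqrtr_sqr.
rewrite {1}[z]complexE (le_trans (ler_normD _ _))// normrM !normC.
by rewrite normc_def /= expr0n /= expr1n add0r sqrtr1 mul1r rmorphD.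
Qed.

Lemma scalar_complete (R : realType) (k : scalar_kind)
  (F : set_system (scalar_field R k)) : ProperFilter F -> cauchy F -> cvg F.
Proof.
case: k F => F FF; first exact: R_complete.
move=> /cauchyP Fc.
have lip_cvg (f : R[i] -> R) :
    (forall x y, `|f x - f y|%:C%C <= `|x - y|) -> cvg (f @ F).
  move=> fL; apply: R_complete; apply: cauchy_exP => e e0.
  have e0' : 0 < e%:C%C :> R[i] by rewrite ltcR.
  have [z Fz] := Fc _ e0'.
  exists (f z); rewrite /nbhs /=; apply: filterS Fz => x.
  rewrite -!ball_normE /= => zx.
  by rewrite -ltcR; apply: le_lt_trans zx.
have /cvg_ex[a Fa] : cvg ((@complex.Re R) @ F).
  by apply: lip_cvg => x y; rewrite -raddfB; exact: normc_ge_Re.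
have /cvg_ex[b Fb] : cvg ((@complex.Im R) @ F).
  apply: lip_cvg => x y; rewrite -raddfB normc_def lecR -sqrtr_sqr.
  by rewrite ler_sqrt ?addr_ge0 ?sqr_ge0// lerDr sqr_ge0.
apply/cvg_ex; exists (Complex a b).
apply/cvgrPdist_lt => e e0.
rewrite (@gt0_of_real R ComplexScalars e e0).
set r := @modulus R ComplexScalars e.
have r0 : 0 < r.
  by rewrite -(of_real_lt ComplexScalars) of_real_modulus of_real0 gtr0_norm.
have r20 : 0 < r / 2 by rewrite divr_gt0.
move/cvgrPdist_lt: Fa => /(_ _ r20) Fa.
move/cvgrPdist_lt: Fb => /(_ _ r20) Fb.
apply: (@filterS2 _ F _ _ _ _ _ Fa Fb) => z za zb.
apply: le_lt_trans (normc_le_ReIm _) _.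
by rewrite ltcR [ltRHS]splitr !raddfB ltrD.

Qed.

Section l1_space.
Variables (R : realType) (k : scalar_kind).
Local Notation K := (scalar_field R k).

Definition l1_summable : {pred nat -> K} :=
  [pred x : nat -> K | `[< cvgn (series (fun n => modulus (x n))) >]].

Lemma summableP (x : nat -> K) :
  reflect (exists M, forall n, series (fun n => modulus (x n)) n <= M)
          (x \in l1_summable).
Proof.
apply: (iffP (asboolP _)) => [cx|[M xM]].
  exists (limn (series (fun n => modulus (x n)))) => n.
  apply: nondecreasing_cvgn_le => //.
  by apply: nondecreasing_series => i _ _; exact: modulus_ge0.
apply: nondecreasing_is_cvgn.
  by apply: nondecreasing_series => i _ _; exact: modulus_ge0.
by exists M => _ [n _ <-].
Qed.

Lemma summable_submod : submod_closed l1_summable.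
Proof.
split=> [|a x y /summableP[M xM] /summableP[N yN]]; apply/summableP.
  by exists 0 => n; rewrite /series /= big1// => i _; exact: modulus0.
exists (modulus a * M + N) => n.
apply: (@le_trans _ _ (modulus a * series (fun n => modulus (x n)) n +
                       series (fun n => modulus (y n)) n)).
  rewrite /series /= mulr_sumr -big_split /=; apply: ler_sum => i _.
  by rewrite -modulusM; exact: modulusD.
by rewrite lerD// ler_wpM2l// modulus_ge0.
Qed.

HB.instance Definition _ :=
  GRing.isSubmodClosed.Build K (nat -> K) l1_summable summable_submod.

Record l1 := L1 { l1_seq :> nat -> K; _ : l1_seq \in l1_summable }.

HB.instance Definition _ := [isSub for l1_seq].
HB.instance Definition _ := [Choice of l1 by <:].
HB.instance Definition _ := [SubChoice_isSubLmodule of l1 by <:].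

Definition l1_norm (x : l1) : K :=
  of_real k (limn (series (fun n => modulus (x n)))).

Lemma l1_cvg (x : l1) : cvgn (series (fun n => modulus (x n))).
Proof. by case: x => x /= /asboolP. Qed.

Lemma l1_norm_ge_series (x : l1) n :
  of_real k (series (fun n => modulus (x n)) n) <= l1_norm x.
Proof.
rewrite of_real_le; apply: nondecreasing_cvgn_le; last exact: l1_cvg.
by apply: nondecreasing_series => i _ _; exact: modulus_ge0.
Qed.

Lemma l1_norm_le (x : l1) (M : R) :
  (forall n, series (fun n => modulus (x n)) n <= M) ->
  l1_norm x <= of_real k M.
Proof.
move=> xM; rewrite of_real_le; apply: limr_le; first exact: l1_cvg.
by apply: nearW => n; exact: xM.
Qed.

Lemma l1_norm_ge (x : l1) n : `|x n| <= l1_norm x.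
Proof.
rewrite -of_real_modulus; apply: le_trans (l1_norm_ge_series x n.+1).
rewrite of_real_le /series /= big_nat_recr//= lerDr.
by apply: sumr_ge0 => i _; exact: modulus_ge0.
Qed.

Lemma l1_normD (x y : l1) : l1_norm (x + y) <= l1_norm x + l1_norm y.
Proof.
rewrite -of_realD; apply: l1_norm_le => n.
apply: (@le_trans _ _ (series (fun n => modulus (x n)) n +
                       series (fun n => modulus (y n)) n)).
  by rewrite /series /= -big_split /=; apply: ler_sum => i _; exact: modulusD.
by rewrite lerD// -(of_real_le k); exact: l1_norm_ge_series.
Qed.

Lemma l1_normZ (a : K) (x : l1) : l1_norm (a *: x) = `|a| * l1_norm x.
Proof.
rewrite -of_real_modulus -of_realM; congr of_real.
have -> : series (fun n => modulus ((a *: x) n)) =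
          modulus a *: series (fun n => modulus (x n)).
  apply/funext => n.
  rewrite -[RHS]/(modulus a * \sum_(0 <= i < n) modulus (x i)).
  by rewrite mulr_sumr; apply: eq_bigr => i _; exact: modulusM.
by rewrite limZl_tmp; [|exact: l1_cvg].
Qed.

Lemma l1_norm_eq0 (x : l1) : l1_norm x = 0 -> x = 0.
Proof.
move=> x0; apply/val_inj/funext => n /=; apply/eqP.
by rewrite -normr_le0 -x0 l1_norm_ge.
Qed.

HB.instance Definition _ :=
  Lmodule_isNormed.Build K l1 l1_normD l1_normZ l1_norm_eq0.

Lemma l1_normE (x : l1) : `|x| = l1_norm x.
Proof. by []. Qed.

Lemma l1_complete (F : set_system l1) : ProperFilter F -> cauchy F -> cvg F.
Proof.
move=> FF /cauchyP Fc.
have coordB (x y : l1) n : (x - y) n = x n - y n by [].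
have cF n : cvg ((fun x : l1 => x n) @ F).
  apply: scalar_complete; apply: cauchy_exP => e e0.
  have [z Fz] := Fc e e0; exists (z n).
  rewrite /nbhs /=; apply: filterS Fz => x.
  rewrite -!ball_normE /= => zx.
  by apply: le_lt_trans zx; rewrite -coordB; exact: l1_norm_ge.
pose a (n : nat) : K := lim ((fun x : l1 => x n) @ F).
have near_le (e : R) : 0 < e ->
    F [set x : l1 | forall n, series (fun i => modulus (x i - a i)) n <= e].
  move=> e0; have e20 : 0 < of_real k (e / 2).
    by rewrite -(of_real0 R k) of_real_lt divr_gt0.
  have [z Fz] := Fc _ e20; apply: filterS (Fz) => x zx n.
  have xa : (fun y : l1 => series (fun i => modulus (x i - y i)) n) @ F -->
            series (fun i => modulus (x i - a i)) n.
    rewrite /series /=; elim: n => [|n IHn].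
      by rewrite big_geq//; under eq_fun do rewrite big_geq//; exact: cvg_cst.
    rewrite big_nat_recr//=; under eq_fun do rewrite big_nat_recr//=.
    apply: cvgD => //; apply: modulus_cvg.
    by apply: cvgB; [exact: cvg_cst|exact: cF].
  apply: (cvgr_to_le xa); apply: filterS Fz => y zy.
  rewrite -(of_real_le k).
  apply: (@le_trans _ _ (l1_norm (x - y))).
    exact: l1_norm_ge_series (x - y) n.
  rewrite -l1_normE; apply: ltW.
  rewrite [e]splitr of_realD; move: zx zy; rewrite -!ball_normE /= => zx zy.
  rewrite -(subrK z x) -addrA; apply: le_lt_trans (ler_normD _ _) _.
  by rewrite ltrD// distrC.
have [x xa] : exists x : l1, forall n,
    series (fun i => modulus (x i - a i)) n <= 1.
  by have /filter_ex := near_le 1 ltr01.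
have xaS : (fun i => x i - a i) \in l1_summable.
  by apply/summableP; exists 1.
have aS : a \in l1_summable.
  rewrite (_ : a = (x : nat -> K) - (fun i => x i - a i)).
    by rewrite rpredB// (valP x).
  by apply/funext => i; rewrite !fctE subKr.
apply/cvg_ex; exists (L1 aS); apply/cvgrPdist_le => e e0.
have e0' : 0 < modulus e.
  by rewrite -(of_real_lt k) of_real_modulus of_real0 gtr0_norm.
apply: filterS (near_le _ e0') => y ya.
by rewrite distrC (gt0_of_real e0) l1_normE; exact: l1_norm_le.
Qed.

HB.instance Definition _ := Uniform_isComplete.Build l1 l1_complete.

End l1_space.

Arguments l1 R k : clear implicits.

Definition separable_space (T : topologicalType) : Prop :=
  exists2 A : set T, countable A & dense A.

Definition bounded_operator (R : realType) (k : scalar_kind)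
    (V W : normedModType (scalar_field R k)) (T : V -> W) : Prop :=
  exists M : R, forall x : V, `|T x| <= of_real k M * `|x|.

(* Meaningful only for bounded [T]: [sup] of an unbounded set is [0]. *)
Definition opnorm (R : realType) (k : scalar_kind)
    (V W : normedModType (scalar_field R k)) (T : V -> W) : R :=
  sup [set modulus `|T x| | x in [set x : V | `|x| <= 1]].

Definition linear_factor (K : numFieldType) (X E : completeNormedModType K)
    (T : {linear X -> X}) (S : {linear E -> E}) : Prop :=
  exists p : {linear E -> X},
    [/\ continuous p, range p = [set: X] & T \o p = p \o S].

(* Main.v *)
Require Import Defs.
From HB Require Import structures.
From mathcomp Require Import all_boot all_order all_algebra.
From mathcomp Require Import all_classical all_reals all_analysis.
From mathcomp Require Import lra.

Set Implicit Arguments.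
Unset Strict Implicit.
Unset Printing Implicit Defensive.

Import numFieldNormedType.Exports.
Local Open Scope classical_set_scope.
Local Open Scope ring_scope.
Import Order.TTheory GRing.Theory Num.Theory.

(** The operator is a shift of infinite multiplicity.  Every index is uniquely
[n = 2^j (2 i + 1) - 1], so that [n |-> 2 n + 1] turns the natural numbers into
countably many disjoint half-lines, one starting at each even number [2 i] and
parametrized by [j].  [l1_shift] moves the coordinate at [n] to [2 n + 1]; it is
linear and isometric, hence of norm [1].

Let [T] be an operator on a separable space [X] and [rho >= opnorm T].  A linear
map out of [l1] is the same thing as a bounded family of images of the unit
vectors ([l1_lift]), and [T \o p = p \o (rho \*: l1_shift)] only asks the
images [v n] to satisfy [T (v n) = rho *: v (2 n + 1)] ([l1_lift_shift]).  The
images [v (2 i)] of the first vectors of the half-lines can thus be chosen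
freely in the unit ball, and [v (2 n + 1) = rho^-1 *: T (v n)] extends the
choice along each half-line ([exists_dyadic_rec]) without leaving the unit ball,
because [|T x| <= rho |x|].

Choose for [v (2 i)] the normalized terms of a dense sequence of [X]
([separable_directions]).  Any [y] is then approximated up to [|y| / 2] by the
image of a multiple, of norm at most [2 |y|], of a single unit vector.
Correcting the error again and again, as in the proof of the open mapping
theorem, shows that [p] is onto ([almost_onto_onto]). *)

(** * Recursion and sums along the binary expansion *)

(** Norms take their values in the scalar field, whose order is only partial in
the complex case; [nrm] is the real number behind a norm. *)
Local Notation nrm x := (modulus `|x|).

(** With [n + 1 = 2^j (2 i + 1)], the value at [n] is the [j]-th iterate of [f]
at [w i]. *)
Lemma exists_dyadic_rec (A : Type) (f : A -> A) (w : nat -> A) :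
  exists v : nat -> A,
    (forall n, v n.*2 = w n) /\ (forall n, v n.*2.+1 = f (v n)).
Proof.
exists (fun n => iter (logn 2 n.+1) f (w ((n.+1)`_(2^'))%N./2)); split=> n.
  have odd1 : odd n.*2.+1 by rewrite /= odd_double.
  have pn : ((2^').-nat n.*2.+1)%N by rewrite -odd_2'nat.
  by rewrite lognE dvdn2 odd1 andbF part_pnat_id//= uphalf_double.
rewrite -doubleS -mul2n lognM// partnM// logn_prime//=.
by rewrite (_ : (2`_(2^') = 1)%N) ?mul1n// part_p'nat// pnatNK pnat_id.
Qed.

Lemma sum_odd_half (V : nmodType) (F : nat -> V) n :
  \sum_(0 <= m < n.*2) (if odd m then F m./2 else 0) = \sum_(0 <= m < n) F m.
Proof.
elim: n => [|n IHn]; first by rewrite !big_geq.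
rewrite doubleS !big_nat_recr//= IHn odd_double addr0.
by rewrite uphalf_double.
Qed.

(** * Series and operators over real or complex scalars *)

Section summation.
Variables (R : realType) (k : scalar_kind).
Local Notation K := (scalar_field R k).

Lemma norm_of_real (V : normedModType K) (x : V) : `|x| = of_real k (nrm x).
Proof. by rewrite of_real_modulus normr_id. Qed.

Lemma of_real1 : of_real k 1 = 1 :> K.
Proof. by case: k. Qed.

Lemma of_real_real (r : R) : of_real k r \is Num.real.
Proof. by rewrite realE -(of_real0 R k) !of_real_le le_total. Qed.

Lemma absolutely_summable_cvg (V : completeNormedModType K) (u : nat -> V)
    (M : R) :
  (forall n, \sum_(0 <= i < n) nrm (u i) <= M) -> cvgn (series u).
Proof.
move=> uM.
have : cvgn (series (fun i => nrm (u i))).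
  apply: nondecreasing_is_cvgn.
    by apply: nondecreasing_series => i _ _; exact: modulus_ge0.
  by exists M => _ [n _ <-]; exact: uM.
move=> /cauchy_cvgP/cauchy_seriesP cu.
apply/cauchy_cvgP/cauchy_seriesP => e e0.
rewrite (gt0_of_real e0); have e0' : 0 < modulus e.
  by rewrite -(of_real_lt k) of_real_modulus of_real0 gtr0_norm.
apply: filterS (cu _ e0') => n; rewrite -(of_real_lt k).
apply: le_lt_trans.
rewrite (le_trans (ler_norm_sum _ _ _))// ger0_norm; last first.
  by apply: sumr_ge0 => i _; exact: modulus_ge0.
rewrite (big_morph _ (of_realD k) (of_real0 R k)).
by apply: ler_sum => i _; rewrite -norm_of_real.
Qed.

(** The triangle inequality for infinite sums.  The limit is taken on the real
moduli, where closed inequalities pass to the limit. *)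
Lemma norm_lim_series_le (V : completeNormedModType K) (u : nat -> V) (l : V)
    (M : R) :
  (forall n, \sum_(0 <= i < n) nrm (u i) <= M) -> series u @ \oo --> l ->
  `|l| <= of_real k M.
Proof.
move=> uM ul; rewrite norm_of_real of_real_le.
have nl : (fun n => nrm (series u n)) @ \oo --> nrm l.
  by apply: modulus_cvg; exact: cvg_norm.
apply: (cvgr_to_le nl).
apply: nearW => n; apply: le_trans (uM n).
rewrite -(of_real_le k) -norm_of_real (big_morph _ (of_realD k) (of_real0 R k)).
rewrite (le_trans (ler_norm_sum _ _ _))//; apply: ler_sum => i _.
by rewrite -norm_of_real.
Qed.

Lemma bounded_operator_continuous (V W : normedModType K)
    (T : {linear V -> W}) : bounded_operator T -> continuous T.
Proof.
move=> [M TM]; apply: bounded_linear_continuous.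
apply/linear_boundedP; exists (of_real k M); split.
  exact: of_real_real.
by move=> r Mr x; rewrite (le_trans (TM x))// ler_wpM2r// ltW.
Qed.

Lemma bounded_operatorP (V W : normedModType K) (T : {linear V -> W}) :
  bounded_operator T -> forall x, `|T x| <= of_real k (opnorm T) * `|x|.
Proof.
move=> [M TM] x; have [->|x0] := eqVneq x 0.
  by rewrite linear0 !normr0 mulr0.
rewrite -ler_pdivrMr ?normr_gt0// [leLHS](_ : _ = `|T (`|x|^-1 *: x)|).
  rewrite norm_of_real of_real_le; apply: sup_ubound; last first.
    exists (`|x|^-1 *: x) => //=.
    by rewrite normrZ normfV normr_id mulVf ?normr_eq0.
  exists `|M| => _ [y /= y1 <-].
  rewrite -(of_real_le k) -norm_of_real (le_trans (TM y))//.
  apply: (@le_trans _ _ (of_real k `|M| * `|y|)).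
    by rewrite ler_wpM2r// of_real_le ler_norm.
  by rewrite ler_piMr// -(of_real0 R k) of_real_le.
by rewrite linearZ normrZ normfV normr_id mulrC.
Qed.

(** The iteration step of the open mapping theorem.  The successive remainders
[r n] satisfy [|r n.+1| <= |r n| / 2], so [|r n| <= 2 (|r n| - |r n.+1|)]: the
sum of their norms telescopes to at most [2 |y|], which makes the series of
corrections [g (r n)] converge absolutely, to a preimage of [y]. *)
Lemma almost_onto_onto (E X : completeNormedModType K) (p : {linear E -> X})
    (C : R) :
  continuous p -> 0 <= C ->
  (forall y, exists e, `|e| <= of_real k C * `|y| /\ `|y - p e| <= `|y| / 2) ->
  range p = [set: X].
Proof.
move=> pc C0 /choice[g gP]; apply/seteqP; split=> // y _.
pose r n := iter n (fun z => z - p (g z)) y.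
have r_half n : nrm (r n.+1) *+ 2 <= nrm (r n).
  rewrite mulr2n -(of_real_le k) of_realD -!norm_of_real.
  by have [_] := gP (r n); rewrite ler_pdivlMr// mulr_natr mulr2n.
have rM n : \sum_(0 <= i < n) nrm (r i) <= nrm y *+ 2.
  suff: \sum_(0 <= i < n) nrm (r i) <= (nrm y - nrm (r n)) *+ 2.
    move=> /le_trans; apply; rewrite ler_pMn2r// gerBl; exact: modulus_ge0.
  elim: n => [|n IHn]; first by rewrite big_geq// subrr mul0rn.
  rewrite big_nat_recr//=; apply: (le_trans (lerD IHn (lexx _))).
  by have := r_half n; rewrite !mulr2n; lra.
have uM n : \sum_(0 <= i < n) nrm (g (r i)) <= C * (nrm y *+ 2).
  apply: le_trans (ler_wpM2l C0 (rM n)); rewrite mulr_sumr.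
  apply: ler_sum => i _.
  by rewrite -(of_real_le k) of_realM -!norm_of_real; case: (gP (r i)).
have gl := absolutely_summable_cvg uM.
exists (limn (series (fun i => g (r i)))) => //.
have pE n : p (series (fun i => g (r i)) n) = y - r n.
  rewrite /series /= raddf_sum; elim: n => [|n IHn].
    by rewrite big_geq// subrr.
  by rewrite big_nat_recr//= IHn opprB addrA addrAC.
apply: (@cvg_unique _ (@norm_hausdorff _ X) ((fun n => y - r n) @ \oo)).
  by rewrite /= -(funext pE); apply: continuous_cvg => //; exact: pc.
rewrite /= -[X in _ --> X]subr0; apply: cvgB; first exact: cvg_cst.
exact: cvg_series_cvg_0 (absolutely_summable_cvg rM).
Qed.

(** The [w n] are the normalized terms [a n] of a dense sequence.  Multiplying
back by [c = |a n|] recovers [a n] itself, also when [a n = 0]; the term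
of the sequence that approximates [y] up to [|y| / 2] has norm at most [2 |y|],
which bounds [c]. *)
Lemma separable_directions (X : completeNormedModType K) :
  separable_space X ->
  exists w : nat -> X, (forall n, `|w n| <= 1) /\
    forall y, exists n (c : K), `|c| <= 2 * `|y| /\ `|y - c *: w n| <= `|y| / 2.
Proof.
move=> [A /countable_injP[f finj] dA].
(* The default [0] only fills the codes [n] that no point of [A] has. *)
pose a n := xget 0 [set x | A x /\ f x = n].
exists (fun n => `|a n|^-1 *: a n); split=> [n|y].
  rewrite normrZ normfV normr_id; have [->|a0] := eqVneq (a n) 0.
    by rewrite normr0 mulr0.
  by rewrite mulVf ?normr_eq0.
have [->|y0] := eqVneq y 0.
  by exists 0, 0; rewrite scale0r subr0 !normr0 mulr0 mul0r.
have y20 : 0 < `|y| / 2 by rewrite divr_gt0 ?normr_gt0.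
have [z [yz Az]] : ball y (`|y| / 2) `&` A !=set0.
  by apply: dA; [exists y; exact: ballxx|exact: ball_open].
have az : a (f z) = z.
  have [Aa fa] : A (a (f z)) /\ f (a (f z)) = f z.
    by apply: (@xgetPex _ 0 [set x | A x /\ f x = f z]); exists z.
  by apply: finj => //; exact: mem_set.
have {}yz : `|y - z| <= `|y| / 2 by move: yz; rewrite -ball_normE => /ltW.
exists (f z), `|z|; rewrite az; split.
  rewrite normr_id -[z](subKr y) (le_trans (ler_normB _ _))//.
  rewrite mulrDl mul1r lerD2l (le_trans yz)// ler_pdivrMr// ler_peMr//.
  by rewrite ler1n.
have [z0|z0] := eqVneq z 0; last first.
  by rewrite scalerA divff ?normr_eq0// scale1r.
by move: yz; rewrite z0 !scaler0.
Qed.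

End summation.

(** * The shift of infinite multiplicity on l1 *)

Section l1_space.
Variables (R : realType) (k : scalar_kind).
Local Notation K := (scalar_field R k).
Local Notation l1 := (l1 R k).

Lemma sum_delta_le1 (n N : nat) :
  \sum_(0 <= m < N) modulus ((m == n)%:R : K) <= 1.
Proof.
have mE m : modulus ((m == n)%:R : K) = (m == n)%:R.
  apply: (@of_real_inj R k); rewrite of_real_modulus normr_nat.
  by case: eqP => _; rewrite ?of_real1 ?of_real0.
under eq_bigr do rewrite mE.
have [nN|Nn] := ltnP n N.
  rewrite (bigD1_seq n) ?iota_uniq ?mem_index_iota//= eqxx.
  by rewrite big1 ?addr0// => m /negbTE->.
by rewrite big_nat big1// => m /andP[_ mN]; rewrite ltn_eqF// (leq_trans mN).
Qed.

Lemma delta_summable (n : nat) :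
  (fun m => (m == n)%:R : K) \in @l1_summable R k.
Proof. by apply/summableP; exists 1 => N; exact: sum_delta_le1. Qed.

Definition l1_delta (n : nat) : l1 := L1 (delta_summable n).

Lemma l1_delta_norm n : `|l1_delta n| = 1.
Proof.
apply/le_anti/andP; split.
  by rewrite -(of_real1 R k); apply: l1_norm_le => N; exact: sum_delta_le1.
by apply: le_trans (l1_norm_ge (l1_delta n) n); rewrite /= eqxx normr1.
Qed.

Lemma l1_sum_le (x : l1) n : \sum_(0 <= i < n) modulus (x i) <= nrm x.
Proof. by rewrite -(of_real_le k) -norm_of_real; exact: l1_norm_ge_series. Qed.

(** [l1] is the free Banach space on the natural numbers: any family in a unit
ball extends to the map [x |-> \sum_n x n *: v n].  The convergence is part of
the conclusion because it determines [p]. *)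
Lemma l1_lift (X : completeNormedModType K) (v : nat -> X) :
  (forall n, `|v n| <= 1) ->
  exists p : {linear l1 -> X},
    continuous p /\
    forall x : l1, series (fun n => x n *: v n) @ \oo --> p x.
Proof.
move=> v1.
have vM (x : l1) n : \sum_(0 <= i < n) nrm (x i *: v i) <= nrm x.
  apply: le_trans (l1_sum_le x n); apply: ler_sum => i _.
  by rewrite -(of_real_le k) -norm_of_real of_real_modulus normrZ ler_piMr.
pose p (x : l1) : X := limn (series (fun n => x n *: v n)).
have pP (x : l1) : series (fun n => x n *: v n) @ \oo --> p x.
  exact: absolutely_summable_cvg (vM x).
have plin : linear p.
  move=> a x y; apply: cvg_lim; first exact: norm_hausdorff.
  have -> : series (fun n => (a *: x + y) n *: v n) =
      (fun n => a *: series (fun n => x n *: v n) n +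
                series (fun n => y n *: v n) n).
    apply/funext => n; rewrite /series /= scaler_sumr -big_split /=.
    by apply: eq_bigr => i _; rewrite scalerA -scalerDl.
  by apply: cvgD => //; apply: cvgZr.
pose P := GRing.isLinear.Build K l1 X *:%R p plin.
pose q : {linear l1 -> X} := HB.pack p P.
exists q; split=> //; apply: bounded_operator_continuous.
exists 1 => x; rewrite of_real1 mul1r (norm_of_real x).
exact: norm_lim_series_le (vM x) (pP x).
Qed.

Lemma l1_lift_delta (X : completeNormedModType K) (v : nat -> X)
    (p : l1 -> X) n :
  (forall x : l1, series (fun n => x n *: v n) @ \oo --> p x) ->
  p (l1_delta n) = v n.
Proof.
move=> /(_ (l1_delta n)) pn.
apply: (cvg_unique (@norm_hausdorff _ X) pn).
apply: cvg_near_cst; exists n.+1 => // N /= nN.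
rewrite /series /= (bigD1_seq n) ?iota_uniq ?mem_index_iota//=.
rewrite eqxx scale1r big1 ?addr0// => m /negbTE->.
by rewrite scale0r.
Qed.

(** The coordinates of the shifted sequence below [n.*2] are those of [x] below
[n], separated by zeros: both bounds of the isometry come from here. *)
Lemma shift_sum_double (x : l1) n :
  \sum_(0 <= i < n.*2) modulus (if odd i then x i./2 else 0) =
  \sum_(0 <= i < n) modulus (x i).
Proof.
rewrite -[RHS]sum_odd_half; apply: eq_bigr => i _.
by case: ifP => // _; exact: modulus0.
Qed.

Lemma shift_sum_le (x : l1) n :
  \sum_(0 <= i < n) modulus (if odd i then x i./2 else 0) <= nrm x.
Proof.
apply: le_trans (l1_sum_le x n); rewrite -shift_sum_double.
rewrite [leRHS](@big_cat_nat _ _ _ n)//= -?addnn ?leq_addr// lerDl.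
by apply: sumr_ge0 => i _; exact: modulus_ge0.
Qed.

Lemma shift_summable (x : l1) :
  (fun n => if odd n then x n./2 else 0 : K) \in @l1_summable R k.
Proof. by apply/summableP; exists (nrm x) => n; exact: shift_sum_le. Qed.

Definition l1_shift (x : l1) : l1 := L1 (shift_summable x).

Lemma l1_shift_linear : linear l1_shift.
Proof.
move=> a x y; apply/val_inj/funext => n.
rewrite -[RHS]/(a * l1_shift x n + l1_shift y n) /=.
by case: odd => //; rewrite mulr0 addr0.
Qed.

HB.instance Definition _ :=
  GRing.isLinear.Build K l1 l1 *:%R l1_shift l1_shift_linear.

Lemma l1_shift_norm x : `|l1_shift x| = `|x|.
Proof.
apply/le_anti/andP; split.
  by rewrite (norm_of_real x); apply: l1_norm_le => n; exact: shift_sum_le.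
rewrite (norm_of_real (l1_shift x)); apply: l1_norm_le => n.
by rewrite /series /= -shift_sum_double; exact: (l1_sum_le (l1_shift x)).
Qed.

(** Both sides send [x] to [\sum_n x n *: T (v n)].  The partial sums agree only
after doubling the number of terms on the shifted side, so limits are compared
along the even partial sums. *)
Lemma l1_lift_shift (X : completeNormedModType K) (v : nat -> X)
    (p : {linear l1 -> X}) (T : {linear X -> X}) (c : K) :
  (forall x : l1, series (fun n => x n *: v n) @ \oo --> p x) ->
  continuous T -> (forall n, T (v n) = c *: v n.*2.+1) ->
  T \o p = p \o (c \*: l1_shift).
Proof.
move=> pv Tc Tv; apply/funext => x /=.
have dbl : (fun n => n.*2) @ \oo --> \oo.
  apply/cvgnyPge => N; exists N => // n /= Nn.
  by rewrite (leq_trans Nn)// -addnn leq_addr.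
have c1 : T (series (fun n => x n *: v n) n) @[n --> \oo] --> T (p x).
  by apply: continuous_cvg; [exact: Tc|exact: pv].
apply: (cvg_unique (@norm_hausdorff _ X) c1).
have c2 := cvg_comp _ _ dbl (pv (c *: l1_shift x)).
rewrite (_ : (fun n => T _) =
  (series (fun n => (c *: l1_shift x) n *: v n) \o (fun n => n.*2)))//.
apply/funext => n; rewrite /series /= raddf_sum -[LHS]sum_odd_half.
apply: eq_bigr => i _.
rewrite -[X in _ = X *: v i]/(c * l1_shift x i) /=.
case: ifP => io; last by rewrite mulr0 scale0r.
rewrite linearZ /= Tv scalerA mulrC.
by have := odd_double_half i; rewrite io add1n => ->.
Qed.

End l1_space.

(** * Linear factors *)

Theorem theorem3p1 (R : realType) (k : scalar_kind) :
  exists U : {linear l1 R k -> l1 R k},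
    [/\ bounded_operator U,
        opnorm U = 1 &
        forall (X : completeNormedModType (scalar_field R k))
               (T : {linear X -> X}) (rho : R),
          separable_space X -> bounded_operator T -> opnorm T <= rho ->
          linear_factor T (of_real k rho \*: U)].
Proof.
exists (@l1_shift R k : {linear l1 R k -> l1 R k}); split.
- by exists 1 => x; rewrite of_real1 mul1r l1_shift_norm.
- rewrite /opnorm; set S := (X in sup X).
  have S1 : ubound S 1.
    move=> _ [x /= x1 <-]; rewrite -(of_real_le k) of_real1 -norm_of_real.
    by rewrite l1_shift_norm.
  have S1' : S 1.
    exists (l1_delta R k 0) => /=; first by rewrite l1_delta_norm.
    apply: (@of_real_inj R k); rewrite -norm_of_real of_real1.
    by rewrite l1_shift_norm l1_delta_norm.
  apply/le_anti/andP; split; first by apply: ge_sup => //; exists 1.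
  by apply: ub_le_sup => //; exists 1.
move=> X T rho sX bT Trho.
have T_le x : `|T x| <= of_real k rho * `|x|.
  rewrite (le_trans (bounded_operatorP bT x))// ler_wpM2r//.
  by rewrite of_real_le.
have [w [w1 wP]] := separable_directions sX.
pose c : scalar_field R k := of_real k rho.
have [v [vw vT]] := exists_dyadic_rec (fun x => c^-1 *: T x) w.
have Tv n : T (v n) = c *: v n.*2.+1.
  (* For [rho = 0] the convention [0^-1 = 0] makes [v] vanish off the even
     indices, and [T = 0]: the relation still holds. *)
  rewrite vT scalerA; have [c0|c0] := eqVneq c 0; last first.
    by rewrite divff// scale1r.
  rewrite c0 mul0r scale0r; apply/eqP; rewrite -normr_le0.
  by rewrite (le_trans (T_le _))// -/c c0 mul0r.
have v1 n : `|v n| <= 1.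
  elim/ltn_ind: n => n IHn; rewrite -(odd_double_half n).
  case: (boolP (odd n)) => [no|_]; last by rewrite vw.
  rewrite add1n vT normrZ normfV.
  have /IHn vn1 : (n./2 < n)%N.
    by rewrite ltn_half_double -addnn -addn1 leq_add2l; case: (n) no.
  have [->|c0] := eqVneq c 0; first by rewrite normr0 invr0 mul0r.
  rewrite ler_pdivrMl ?normr_gt0// mulr1 (le_trans (T_le _))// -/c.
  have cc : c <= `|c| := real_ler_norm (of_real_real k rho).
  by rewrite (le_trans (ler_wpM2r _ cc))// ler_piMr.
have [p [pc pv]] := l1_lift v1.
exists p; split=> //; last first.
  by apply: l1_lift_shift pv _ Tv; exact: bounded_operator_continuous.
apply: (@almost_onto_onto _ _ _ _ _ 2) => // y.
have [n [a [ay yw]]] := wP y.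
exists (a *: l1_delta R k n.*2); split.
  rewrite normrZ l1_delta_norm mulr1 (le_trans ay)// ler_wpM2r//.
  by rewrite (_ : of_real k 2 = 2)// of_realD of_real1.
by rewrite linearZ /= (l1_lift_delta _ pv) vw.
Qed.
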